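(* Let $Q_{R,d}$ and $Q_R$ be formal Laurent series in $\mathbb{Q}((x))$, for all data $R$ and all $d\in\mathbb{Z}$, satisfying for every $R$ and $d$ $$Q_R(x)=\sum_{r\ge1}\sum_{I:\ \ell(I)=r}\ \sum_{(d_1,\dots,d_r)}x^{N_R(I;d_1,\dots,d_r)}\prod_{k=1}^rQ_{R^I_k,d_k}(x),$$ with $(d_1,\dots,d_r)\in\mathbb{Z}^r$, $\sum d_i=d$, $\frac{d_1+\alpha(R^I_1)}{n(R^I_1)}>\dots>\frac{d_r+\alpha(R^I_r)}{n(R^I_r)}$. For a real $\lambda$ put $$Q^\lambda_{R,d}(x)=\sum_{r\ge1}\sum_{I:\ \ell(I)=r}\ \sum_{(d_1,\dots,d_r)}^{(\lambda)}x^{N_R(I;d_1,\dots,d_r)}\prod_{k=1}^rQ_{R^I_k,d_k}(x),$$ where the inner sum is over $(d_1,\dots,d_r)\in\mathbb{Z}^r$ with $\sum d_i=d$ and $\lambda\ge\frac{d_1+\alpha(R^I_1)}{n(R^I_1)}>\frac{d_2+\alpha(R^I_2)}{n(R^I_2)}>\dots>\frac{d_r+\alpha(R^I_r)}{n(R^I_r)}$, and $$S^\lambda_{R,d}(x)=\sum_{r\ge1}\sum_{I:\ \ell(I)=r}\frac{x^{M'_R(I;d)+M_R(I;\lambda)}}{(x^{n(R^I_1)+n(R^I_2)}-1)\cdots(x^{n(R^I_{r-1})+n(R^I_r)}-1)}\prod_{k=1}^rQ_{R^I_k}(x).$$ Then $Q^\lambda_{R,d}=S^\lambda_{R,d}$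 for every data $R$, every $d\in\mathbb{Z}$ and every real $\lambda\ge(d+\alpha(R))/n(R)$.
   Context: Fix a finite set $S$, integers $m_P\ge1$ ($P\in S$) and reals $0\le\alpha^P_1<\dots<\alpha^P_{m_P}<1$. A data $R=(R^P_i)$ is a family of non-negative integers with $n(R)=\sum_iR^P_i$ positive and independent of $P$; $\alpha(R)=\sum_P\sum_iR^P_i\alpha^P_i$. A partition of $R$ of length $r=\ell(I)$ is a family of non-negative integers $I^P_{i,k}$, $1\le k\le r$, with $\sum_kI^P_{i,k}=R^P_i$, $\sum_iI^P_{i,k}$ independent of $P$, and for each $k$ some $I^P_{i,k}\ne0$; $(R^I_k)^P_i=I^P_{i,k}$, $(R^I_{\le k})^P_i=\sum_{k'\le k}I^P_{i,k'}$. Define $\sigma_R(I)=\sum_{P\in S}\sum_{k>l,\ i>t}I^P_{i,k}I^P_{t,l}$, $N_R(I;d_1,\dots,d_r)=\sum_{k>l}(d_ln(R^I_k)-d_kn(R^I_l))-\sigma_R(I)$, $M'_R(I;d)=-(n(R)-n(R^I_r))d-\sigma_R(I)+(2n(R)-n(R^I_1)-n(R^I_r))$, and $M_R(I;\lambda)=\sum_{k=1}^{r-1}(n(R^I_k)+n(R^I_{k+1}))[n(R^I_{\le k})\lambda-\alpha(R^I_{\le k})]$, with $[y]$ the integer part. Factors $1/(x^a-1)$ are expanded in $\mathbb{Q}((x))$. *)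

(* Defs.v *)
From HB Require Import structures.
From mathcomp Require Import all_boot all_order all_algebra.
From mathcomp Require Import reals.
Set Implicit Arguments. Unset Strict Implicit. Unset Printing Implicit Defensive.
Import Order.TTheory GRing.Theory Num.Theory.
Local Open Scope ring_scope.

(* Formal Laurent series Q((x)).  A Laurent series is represented as       *)
(* x^(lval f) * (sum_{k>=0} lcoef f k x^k); its coefficient of x^n (n : int)*)
(* is lcoefZ f n.  Two series are equal iff their lcoefZ agree.            *)
Record laurent := Laurent { lval : int; lcoef : nat -> rat }.

Definition lcoefZ (f : laurent) (n : int) : rat :=
  match (n - lval f)%R with Posz k => lcoef f k | Negz _ => 0 end.

Definition lmul (f g : laurent) : laurent :=
  Laurent (lval f + lval g)
    (fun n => \sum_(k < n.+1) lcoef f k * lcoef g (n - k)%N).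

Definition lxpow (e : int) : laurent :=
  Laurent e (fun n => if n == 0%N then 1 else 0).

Definition lone : laurent := lxpow 0.

Definition lprod (s : seq laurent) : laurent := foldr lmul lone s.

(* 1/(x^a - 1) expanded in Q((x)) (for a > 0):  -(1 + x^a + x^(2a) + ...) *)
Definition linv_xpow_sub1 (a : nat) : laurent :=
  Laurent 0 (fun n => if (a %| n)%N then -1 else 0).

(* Summable families in the x-adic topology of Q((x)) and their sums:     *)
(* the family (F i)_{i | P i} is summable with sum L iff the valuations    *)
(* are uniformly bounded below and each coefficient receives only finitely *)
(* many nonzero contributions, L being the coefficientwise sum.            *)
Definition HasSum (T : eqType) (P : T -> Prop) (F : T -> laurent)
    (L : laurent) : Prop :=
  (exists v : int, forall i, P i -> forall n : int, n < v -> lcoefZ (F i) n = 0)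
  /\ (forall n : int, exists s : seq T,
        [/\ uniq s, (forall i, i \in s -> P i),
            (forall i, P i -> lcoefZ (F i) n != 0 -> i \in s)
          & lcoefZ L n = \sum_(i <- s) lcoefZ (F i) n]).

Section Data.
Variables (S : finType) (m : S -> nat).

(* index set {(P, i) : P in S, 1 <= i <= m_P} (0-based in i) *)
Definition idx : finType := {P : S & 'I_(m P)}.

Definition data := {ffun idx -> nat}.

Definition entry (D : data) (P : S) (i : 'I_(m P)) : nat :=
  D (@existT S (fun P => 'I_(m P)) P i).
Arguments entry D P i : clear implicits.

Definition nP (D : data) (P : S) : nat := (\sum_(i < m P) entry D P i)%N.

(* n(R): the common value of nP (well defined for data) *)
Definition nD (D : data) : nat := (\max_(P : S) nP D P)%N.

Definition is_data (D : data) : Prop :=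
  (forall P P', nP D P = nP D P') /\ (0 < nD D)%N.

(* a partition I of D of length r is the sequence [R^I_1; ...; R^I_r] *)
Definition is_partition (D : data) (I : seq data) : Prop :=
  [/\ (0 < size I)%N,
      (forall j : idx, (\sum_(E <- I) E j)%N = D j)
    & (forall E, E \in I -> (forall P P', nP E P = nP E P') /\ exists j, E j != 0%N)].

Definition d0 : data := [ffun => 0%N].

Definition part (I : seq data) (k : nat) : data := nth d0 I k.
Definition npart (I : seq data) (k : nat) : nat := nD (part I k).

(* R^I_{<= k} (first k parts, k counted from 1) *)
Definition prefix (I : seq data) (k : nat) : data :=
  [ffun j => (\sum_(E <- take k I) E j)%N].

Definition sigma (I : seq data) : nat :=
  (\sum_(P : S) \sum_(k < size I) \sum_(l < size I | l < k)
     \sum_(i < m P) \sum_(t < m P | t < i)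
       entry (part I k) P i * entry (part I l) P t)%N.

Definition Ncoef (I : seq data) (ds : seq int) : int :=
  \sum_(k < size I) \sum_(l < size I | (l < k)%N)
     (nth 0 ds l * (npart I k)%:Z - nth 0 ds k * (npart I l)%:Z)
  - (sigma I)%:Z.

Definition Mprime (D : data) (I : seq data) (d : int) : int :=
  - ((nD D)%:Z - (npart I (size I).-1)%:Z) * d - (sigma I)%:Z
  + (2 * (nD D)%:Z - (npart I 0)%:Z - (npart I (size I).-1)%:Z).

Variables (R : realType) (alpha : forall P : S, 'I_(m P) -> R).

Definition alphaD (D : data) : R :=
  \sum_(P : S) \sum_(i < m P) (entry D P i)%:R * @alpha P i.

Definition Mlam (I : seq data) (lam : R) : int :=
  \sum_(k < (size I).-1)
     ((npart I k + npart I k.+1)%N%:Z *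
      Num.floor ((nD (prefix I k.+1))%:R * lam - alphaD (prefix I k.+1))).

Definition slope (x : data * int) : R :=
  ((x.2)%:~R + alphaD x.1) / (nD x.1)%:R.

(* index of the sums: s = [(R^I_1, d_1); ...; (R^I_r, d_r)] *)
Definition decomp (D : data) (d : int) (s : seq (data * int)) : Prop :=
  [/\ is_partition D (map fst s),
      \sum_(x <- s) x.2 = d
    & sorted (fun a b => b < a) (map slope s)].

Definition decomp_lam (D : data) (d : int) (lam : R) (s : seq (data * int)) : Prop :=
  decomp D d s /\ slope (head (d0, 0) s) <= lam.

Definition Qterm (Q : data -> int -> laurent) (s : seq (data * int)) : laurent :=
  lmul (lxpow (Ncoef (map fst s) (map snd s)))
       (lprod [seq Q x.1 x.2 | x <- s]).

Definition Sterm (Qb : data -> laurent) (D : data) (d : int) (lam : R)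
    (I : seq data) : laurent :=
  lmul (lxpow (Mprime D I d + Mlam I lam))
    (lmul (lprod [seq linv_xpow_sub1 (npart I k + npart I k.+1)
                 | k <- iota 0 (size I).-1])
          (lprod (map Qb I))).

End Data.

(* Main.v *)
Require Import Defs.
From HB Require Import structures.
From mathcomp Require Import all_boot all_order all_algebra.
From mathcomp Require Import reals.
From mathcomp Require Import boolp classical_sets functions cardinality fsbigop.
From mathcomp Require Import finmap ring lra zify.
Import Order.TTheory GRing.Theory Num.Theory.
Set Implicit Arguments. Unset Strict Implicit. Unset Printing Implicit Defensive.
Local Open Scope ring_scope.

(* Idea (after Zagier): as functions of lambda, Q^lambda and S^lambda are right
   continuous step functions with the same limit Q_R at lambda = +oo, by the
   hypothesis on Q and Q_R and because M_R(I; lambda) -> +oo as soon as I has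
   length at least 2.  So it suffices to compare their jumps at
   lambda > (d + alpha(R)) / n(R).  Writing Q^{lambda-}, S^{lambda-} for the left
   limits (strict inequality, resp. [y] replaced by the largest integer < y),
   both satisfy
     F^lambda_{R,d} - F^{lambda-}_{R,d} =
       sum x^{N(R1,R2;d1,d2)} F^lambda_{R1,d1} F^{lambda-}_{R2,d2}
   over R1 + R2 = R, d1 + d2 = d with (d1 + alpha(R1)) / n(R1) = lambda, and one
   concludes by induction on n(R).  For Q^lambda this splits off the first part,
   Q_{R1,d1} being Q^lambda_{R1,d1} at its own slope lambda.  For S^lambda it
   is a telescoping sum over the cuts k of I at which
   n(R_{<=k}) lambda - alpha(R_{<=k}) is an integer. *)

(** * Laurent series as a commutative ring *)

Definition conv (f g : nat -> rat) (n : nat) : rat :=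
  \sum_(k < n.+1) f k * g (n - k)%N.

Definition truncp (N : nat) (f : nat -> rat) : {poly rat} := \poly_(i < N) f i.

(* Reduces the ring laws of Cauchy products to those of polynomials. *)
Lemma conv_truncp N f g n : (n < N)%N -> conv f g n = (truncp N f * truncp N g)`_n.
Proof.
move=> nN; rewrite coefM; apply: eq_bigr => i _.
have iN : (i < N)%N by rewrite (leq_trans (ltn_ord i)).
by rewrite !coef_poly iN (leq_ltn_trans (leq_subr _ _) nN).
Qed.

Lemma convC f g n : conv f g n = conv g f n.
Proof. by rewrite !(@conv_truncp n.+1)// mulrC. Qed.

Lemma convA f g h n : conv f (conv g h) n = conv (conv f g) h n.
Proof.
rewrite /conv.
transitivity (truncp n.+1 f * (truncp n.+1 g * truncp n.+1 h))`_n.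
  rewrite coefM; apply: eq_bigr => i _; rewrite !coef_poly ltn_ord.
  by congr (_ * _); apply: conv_truncp; rewrite ltnS leq_subr.
rewrite mulrA coefM; apply: eq_bigr => i _; rewrite !coef_poly ltnS leq_subr.
by congr (_ * _); apply/esym/conv_truncp.
Qed.

(** Padding with [k] leading zeros yields another record of the same series; it serves to bring two
    records to a common [lval]. *)
Definition lshift (k : nat) (f : laurent) : laurent :=
  Laurent (lval f - k%:Z) (fun n => if (n < k)%N then 0 else lcoef f (n - k)).

Lemma lcoefZ_nat f (k : nat) : lcoefZ f (lval f + k%:Z) = lcoef f k.
Proof. by rewrite /lcoefZ addrAC subrr add0r. Qed.

Lemma lcoefZ_lt f n : n < lval f -> lcoefZ f n = 0.
Proof. by rewrite /lcoefZ; case E : (n - lval f) => [k|k] // H; lia. Qed.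

Lemma lcoefZ_shift k f : lcoefZ (lshift k f) =1 lcoefZ f.
Proof.
move=> n; have [nf|nf] := ltP n (lval f); last first.
  have -> : n = lval f + `|(n - lval f)%R|%N%:Z by lia.
  rewrite lcoefZ_nat; set j := `|_|%N.
  have -> : lval f + j%:Z = lval (lshift k f) + (j + k)%N%:Z by rewrite /=; lia.
  by rewrite lcoefZ_nat /= addnK ifN// -leqNgt leq_addl.
rewrite (lcoefZ_lt nf).
have [?|H] := ltP n (lval f - k%:Z); first by rewrite lcoefZ_lt.
have -> : n = lval (lshift k f) + `|(n - (lval f - k%:Z))%R|%N%:Z by rewrite /=; lia.
by rewrite lcoefZ_nat /= ifT//; lia.
Qed.

Lemma lmul_shift k f g : lcoefZ (lmul (lshift k f) g) =1 lcoefZ (lmul f g).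
Proof.
move=> n; rewrite -[RHS](lcoefZ_shift k).
rewrite /lcoefZ /= [lval f - _ + _]addrAC; case: (n - _) => // {}n.
case: ltnP => nk.
  rewrite big1 // => i _; rewrite ifT ?mul0r//; exact: leq_ltn_trans (leq_ord i) nk.
rewrite -(big_mkord xpredT
  (fun i => (if (i < k)%N then 0 else lcoef f (i - k)) * lcoef g (n - i)%N)).
rewrite -(big_mkord xpredT (fun i => lcoef f i * lcoef g (n - k - i)%N)).
rewrite (@big_cat_nat _ _ _ k)//=; last by rewrite leqW.
rewrite big_nat big1 ?add0r; last by move=> i /andP[_ ->]; rewrite mul0r.
rewrite -{1}[k]add0n big_addn subSn//; apply: eq_big_nat => i _.
by rewrite ltnNge leq_addl addnK -subnDA [(k + i)%N]addnC.
Qed.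

(** Two records of one series differ only by leading zeros, so both can be padded down to the
    smaller [lval]. *)
Lemma lshift_eq f g : lcoefZ f =1 lcoefZ g ->
  exists j k, lval (lshift j f) = lval (lshift k g) /\
    lcoef (lshift j f) =1 lcoef (lshift k g).
Proof.
move=> fg.
exists `|(Num.max 0 (lval f - lval g))%R|%N,
       `|(Num.max 0 (lval g - lval f))%R|%N.
set j := `|_|%N; set k := `|_|%N.
have E : lval (lshift j f) = lval (lshift k g) by rewrite /= /j /k; lia.
split=> // n; rewrite -!lcoefZ_nat !lcoefZ_shift E.
by rewrite fg.
Qed.

Lemma lmulC f g : lcoefZ (lmul f g) =1 lcoefZ (lmul g f).
Proof.
move=> n; rewrite /lcoefZ /= [lval g + _]addrC; case: (n - _) => // k; exact: convC.
Qed.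

(** Makes [lmul] well defined on series: padding turns the left factors into extensionally equal
    records and leaves products unchanged. *)
Lemma eq_lmull f f' g : lcoefZ f =1 lcoefZ f' ->
  lcoefZ (lmul f g) =1 lcoefZ (lmul f' g).
Proof.
move=> ff' n; have [j [k [E1 E2]]] := lshift_eq ff'.
rewrite -(lmul_shift j) -[RHS](lmul_shift k).
rewrite {1}/lcoefZ [RHS]/lcoefZ /=; move: E1 => /= ->; case: (n - _) => // i.
by apply: eq_bigr => l _; move: (E2 l) => /= ->.
Qed.

Lemma lmulA f g h : lcoefZ (lmul f (lmul g h)) =1 lcoefZ (lmul (lmul f g) h).
Proof.
by move=> n; rewrite /lcoefZ /= addrA; case: (n - _) => // k; exact: convA.
Qed.

Definition ladd (f g : laurent) : laurent :=
  let v := Num.min (lval f) (lval g) in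
  Laurent v (fun n => lcoefZ f (v + n%:Z) + lcoefZ g (v + n%:Z)).

Definition lopp (f : laurent) : laurent := Laurent (lval f) (fun n => - lcoef f n).

Lemma lcoefZ_add f g n : lcoefZ (ladd f g) n = lcoefZ f n + lcoefZ g n.
Proof.
rewrite {1}/lcoefZ /=; set v := Num.min _ _.
case E : (n - v) => [k|k]; first by have <- : n = v + k%:Z by lia.
by rewrite !lcoefZ_lt ?addr0//; lia.
Qed.

Lemma lcoefZ_opp f n : lcoefZ (lopp f) n = - lcoefZ f n.
Proof. by rewrite /lcoefZ /=; case: (n - _) => //; rewrite oppr0. Qed.

(** Once [f] and [g] are padded to the common starting exponent [v], distributivity holds term by
    term in the Cauchy products. *)
Lemma lmul_addl f g h :
  lcoefZ (lmul (ladd f g) h) =1 lcoefZ (ladd (lmul f h) (lmul g h)).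
Proof.
move=> n; rewrite lcoefZ_add.
pose v := Num.min (lval f) (lval g).
rewrite -(lmul_shift `|(lval f - v)%R|%N f) -(lmul_shift `|(lval g - v)%R|%N g).
have Ef : lval (lshift `|(lval f - v)%R|%N f) = v by rewrite /= /v; lia.
have Eg : lval (lshift `|(lval g - v)%R|%N g) = v by rewrite /= /v; lia.
have Hf i : lcoefZ f (v + i%:Z) = lcoef (lshift `|(lval f - v)%R|%N f) i.
  by rewrite -lcoefZ_nat lcoefZ_shift Ef.
have Hg i : lcoefZ g (v + i%:Z) = lcoef (lshift `|(lval g - v)%R|%N g) i.
  by rewrite -lcoefZ_nat lcoefZ_shift Eg.
move: (lshift _ f) (lshift _ g) Ef Eg Hf Hg => f' g' Ef Eg Hf Hg.
rewrite /lcoefZ [lval (lmul _ _)]/= [lval (lmul f' _)]/= [lval (lmul g' _)]/=.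
rewrite Ef Eg -/v; case: (n - _) => [k|k]; last by rewrite addr0.
rewrite -big_split; apply: eq_bigr => i _.
by rewrite /= -mulrDl -Hf -Hg.
Qed.

(* Laurent records with the same coefficients are identified by passing to
   their coefficient functions. *)
Definition is_lser : pred (int -> rat) :=
  fun f => `[< exists L, lcoefZ L = f >].

Record lser := LSer { lser_val :> int -> rat; lserP : is_lser lser_val }.
HB.instance Definition _ := [isSub for lser_val].
HB.instance Definition _ := [Equality of lser by <:].
HB.instance Definition _ := [Choice of lser by <:].

Definition ser (L : laurent) : lser := LSer (introT (asboolP _) (ex_intro _ L erefl)).

Definition unser (f : lser) : laurent := projT1 (cid (elimT (asboolP _) (lserP f))).

Lemma unserK : cancel unser ser.
Proof. by move=> f; apply: val_inj => /=; rewrite /unser; case: cid. Qed.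

Lemma lcoefZ_unser f : lcoefZ (unser f) =1 f.
Proof. by move=> n; rewrite -[in RHS](unserK f). Qed.

Lemma eq_ser f g : lcoefZ f =1 lcoefZ g -> ser f = ser g.
Proof. by move=> fg; apply: val_inj; apply: funext. Qed.

(** Lets the ring laws of [lser] be checked on representatives in [laurent]. *)
Lemma lserW (P : lser -> Prop) : (forall L, P (ser L)) -> forall f, P f.
Proof. by move=> H f; rewrite -(unserK f). Qed.

Definition sadd (f g : lser) := ser (ladd (unser f) (unser g)).
Definition sopp (f : lser) := ser (lopp (unser f)).
Definition smul (f g : lser) := ser (lmul (unser f) (unser g)).

Lemma saddE f g n : sadd f g n = f n + g n.
Proof. by rewrite /sadd /= lcoefZ_add !lcoefZ_unser. Qed.

Lemma soppE f n : sopp f n = - f n.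
Proof. by rewrite /sopp /= lcoefZ_opp lcoefZ_unser. Qed.

Definition szero := ser (Laurent 0 (fun=> 0)).
Lemma szeroE n : szero n = 0.
Proof. by rewrite /= /lcoefZ /=; case: (n - 0). Qed.

Lemma lser_eqP (f g : lser) : f =1 g -> f = g.
Proof. by move=> fg; apply: val_inj; apply: funext. Qed.

Lemma saddA : associative sadd.
Proof. by move=> f g h; apply: lser_eqP => n; rewrite !saddE addrA. Qed.
Lemma saddC : commutative sadd.
Proof. by move=> f g; apply: lser_eqP => n; rewrite !saddE addrC. Qed.
Lemma sadd0 : left_id szero sadd.
Proof. by move=> f; apply: lser_eqP => n; rewrite saddE szeroE add0r. Qed.
Lemma saddN : left_inverse szero sopp sadd.
Proof. by move=> f; apply: lser_eqP => n; rewrite saddE szeroE soppE addNr. Qed.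
HB.instance Definition _ := GRing.isZmodule.Build lser saddA saddC sadd0 saddN.

Lemma ser_mul f g : ser (lmul f g) = smul (ser f) (ser g).
Proof.
apply: eq_ser => n; rewrite (@eq_lmull f (unser (ser f))); last first.
  by move=> i; rewrite lcoefZ_unser.
rewrite lmulC [RHS]lmulC; apply: eq_lmull => i; by rewrite lcoefZ_unser.
Qed.

Lemma smulC : commutative smul.
Proof. by elim/lserW=> f; elim/lserW=> g; rewrite -!ser_mul; exact/eq_ser/lmulC. Qed.
Lemma smulA : associative smul.
Proof.
elim/lserW=> f; elim/lserW=> g; elim/lserW=> h; rewrite -!ser_mul.
exact/eq_ser/lmulA.
Qed.
Lemma smul1 : left_id (ser lone) smul.
Proof.
elim/lserW=> f; rewrite -ser_mul; apply: eq_ser => n.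
rewrite /lcoefZ /= add0r; case: (n - _) => // k.
by rewrite big_ord_recl subn0 mul1r big1 ?addr0// => i _; rewrite mul0r.
Qed.
Lemma smulDl : left_distributive smul +%R.
Proof.
elim/lserW=> f; elim/lserW=> g; elim/lserW=> h.
have E f1 f2 : ser f1 + ser f2 = ser (ladd f1 f2).
  by apply: lser_eqP => n; rewrite saddE /= lcoefZ_add.
by rewrite E -!ser_mul E; apply/eq_ser/lmul_addl.
Qed.
Lemma sone_neq0 : ser lone != 0.
Proof.
apply/eqP => /(congr1 (fun f : lser => f 0)) /=.
by rewrite /lcoefZ /= => /eqP; rewrite oner_eq0.
Qed.
HB.instance Definition _ :=
  GRing.Zmodule_isComNzRing.Build lser smulA smulC smul1 smulDl sone_neq0.

Definition coefs (n : int) (f : lser) : rat := f n.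
Arguments coefs : simpl never.
Lemma coefs_is_zmod_morphism n : zmod_morphism (coefs n).
Proof.
by move=> f g; rewrite /coefs [LHS]saddE; congr (_ + _); exact: soppE.
Qed.
HB.instance Definition _ n :=
  GRing.isZmodMorphism.Build lser rat (coefs n) (coefs_is_zmod_morphism n).

Lemma ser_lmul f g : ser (lmul f g) = ser f * ser g.
Proof. exact: ser_mul. Qed.

Lemma ser_lprod s : ser (lprod s) = \prod_(f <- s) ser f.
Proof. by elim: s => [|f s IH]; rewrite ?big_nil// big_cons -IH -ser_lmul. Qed.

Definition xpow (e : int) : lser := ser (lxpow e).

Lemma xpowD e f : xpow (e + f) = xpow e * xpow f.
Proof.
rewrite -ser_lmul; apply: eq_ser => n; rewrite /lcoefZ /=; case: (n - _) => // k.
rewrite big_ord_recl subn0 mul1r big1 ?addr0// => i _; by rewrite mul0r.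
Qed.

Lemma xpow0 : xpow 0 = 1. Proof. by []. Qed.

Lemma coef_xpowM e f n : coefs n (xpow e * f) = coefs (n - e) f.
Proof.
elim/lserW: f => f; rewrite -ser_lmul /coefs /= /lcoefZ /=.
rewrite opprD addrA; case: (n - _ - _) => // k.
by rewrite big_ord_recl subn0 mul1r big1 ?addr0// => i _; rewrite mul0r.
Qed.

Lemma coef_lt (f : lser) : exists v, forall n, n < v -> coefs n f = 0.
Proof. by elim/lserW: f => f; exists (lval f) => n; exact: lcoefZ_lt. Qed.

(** Geometric series: multiplication by [x^a - 1] cancels every coefficient except the one at 0. *)
Lemma mul_linv (a : nat) : (0 < a)%N -> (xpow a%:Z - 1) * ser (linv_xpow_sub1 a) = 1.
Proof.
move=> a0; apply: lser_eqP => n.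
rewrite mulrBl mul1r -[LHS]/(coefs n _) -[RHS]/(coefs n _).
rewrite raddfB /= coef_xpowM /coefs /= /lcoefZ /= !subr0.
case: n => n /=.
  case: (ltnP n a) => na.
    have /= -> : (Posz n - Posz a) = Negz (a - n.+1) by lia.
    rewrite sub0r; case: n na => [|n] na; first by rewrite dvdn0 opprK.
    by rewrite gtnNdvd//= oppr0.
  have -> : (Posz n - Posz a) = Posz (n - a) by lia.
  have -> : (n == 0)%N = false by lia.
  by rewrite dvdn_subl//; case: ifP => _; rewrite subrr.
have -> : (Negz n - Posz a) = Negz (n + a) by lia.
by rewrite subr0.
Qed.

(** * Data, partitions and exponents *)

(** Recursive form of the double sums over positions [l < k] in sigma and N, suited to concatenation
    of partitions. *)
Fixpoint pairsum (V : nmodType) (T : Type) (G : T -> T -> V) (s : seq T) : V :=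
  if s is x :: s' then \sum_(y <- s') G x y + pairsum G s' else 0.

Lemma pairsum_nth (V : nmodType) (T : Type) (x0 : T) (G : T -> T -> V) s :
  \sum_(k < size s) \sum_(l < size s | (l < k)%N) G (nth x0 s l) (nth x0 s k)
    = pairsum G s.
Proof.
elim: s => [|x s IH] /=; first by rewrite big_ord0.
rewrite big_ord_recl big_pred0// add0r -IH (big_nth x0) big_mkord -big_split /=.
by apply: eq_bigr => k _; rewrite big_mkcond big_ord_recl -big_mkcond.
Qed.

Lemma pairsum_cat (V : nmodType) (T : Type) (G : T -> T -> V) s t :
  pairsum G (s ++ t) =
    pairsum G s + pairsum G t + \sum_(x <- s) \sum_(y <- t) G x y.
Proof.
elim: s => [|x s IH] /=; first by rewrite big_nil addr0 add0r.
rewrite IH big_cat big_cons /= -!addrA; congr (_ + _).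
by rewrite addrCA; congr (_ + _); rewrite addrCA.
Qed.

Section Data.
Variables (S : finType) (m : S -> nat).
Local Notation data := (data m).
Implicit Types (D E F : data) (I J : seq data).

Definition balanced E := forall P P', nP E P = nP E P'.

Lemma nP_add E F P : nP (E + F) P = (nP E P + nP F P)%N.
Proof. by rewrite /nP -big_split; apply: eq_bigr => i _; rewrite /entry ffunE. Qed.

Lemma nP0 P : nP (0 : data) P = 0%N.
Proof. by rewrite /nP big1// => i _; rewrite /entry ffunE. Qed.

Lemma balanced_nD E P : balanced E -> nD E = nP E P.
Proof.
move=> bE; apply/eqP; rewrite eqn_leq /nD leq_bigmax andbT.
by apply/bigmax_leqP => P' _; rewrite (bE P' P).
Qed.

Lemma balancedD E F : balanced E -> balanced F -> balanced (E + F).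
Proof. by move=> bE bF P P'; rewrite !nP_add (bE P P') (bF P P'). Qed.

Lemma nD_add E F : balanced E -> balanced F -> nD (E + F) = (nD E + nD F)%N.
Proof.
(* For empty [S] the maxima defining [nD] are empty and all vanish; otherwise any point computes
   them. *)
move=> bE bF; case: (pickP S) => [P _|S0].
  by rewrite !(balanced_nD P)// ?nP_add//; exact: balancedD.
by rewrite /nD !big_pred0.
Qed.

Lemma nD0 : nD (0 : data) = 0%N.
Proof. by rewrite /nD big1// => P _; rewrite nP0. Qed.

Lemma is_dataP E : is_data E <-> balanced E /\ exists j, E j != 0%N.
Proof.
split=> -[bE H]; split=> //.
  apply: contrapT => H0; move: H; have -> : E = 0; last by rewrite nD0.
  by apply/ffunP => j; rewrite ffunE; apply/eqP/negPn/negP => Hj; apply: H0; exists j.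
have [[P i] Hj] := H; rewrite (balanced_nD P)// /nP (bigD1 i)//= /entry.
by rewrite addn_gt0 lt0n Hj.
Qed.

Lemma nD_sum I : (forall E, E \in I -> is_data E) ->
  balanced (\sum_(E <- I) E) /\ nD (\sum_(E <- I) E) = (\sum_(E <- I) nD E)%N.
Proof.
elim: I => [|E I IH] H; first by rewrite !big_nil nD0; split=> // P P'; rewrite !nP0.
have [b1 e1] : balanced (\sum_(E <- I) E) /\
    nD (\sum_(E <- I) E) = (\sum_(E <- I) nD E)%N.
  by apply: IH => F FI; apply: H; rewrite inE FI orbT.
have [bE _] : is_data E by apply: H; rewrite inE eqxx.
by rewrite !big_cons nD_add// e1; split=> //; exact: balancedD.
Qed.

Lemma is_data_sum I : I != [::] -> (forall E, E \in I -> is_data E) ->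
  is_data (\sum_(E <- I) E).
Proof.
move=> I0 H; have [b e] := nD_sum H; split=> //; rewrite e.
case: I I0 H {b e} => // E I _ H; rewrite big_cons addn_gt0.
by have [_ ->] : is_data E by apply: H; rewrite inE eqxx.
Qed.

Lemma partitionP D I : is_partition D I <->
  [/\ I != [::], \sum_(E <- I) E = D & forall E, E \in I -> is_data E].
Proof.
rewrite /is_partition -size_eq0 -lt0n; split=> -[s0 sD H]; split=> //.
- by apply/ffunP => j; rewrite sum_ffunE -sD.
- by move=> E EI; apply/is_dataP; exact: H.
- by move=> j; rewrite -sD sum_ffunE.
- by move=> E EI; apply/is_dataP; exact: H.
Qed.

Lemma partition_nD D I : is_partition D I -> nD D = (\sum_(E <- I) nD E)%N.
Proof. by move=> /partitionP[_ <- /nD_sum[]]. Qed.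

Lemma prefix_sum I k : Defs.prefix I k = \sum_(E <- take k I) E.
Proof. by apply/ffunP => j; rewrite ffunE sum_ffunE. Qed.

(** Contribution to sigma of an earlier part [E] and a later part [F]. It is biadditive, so two
    blocks of a partition interact only through their sums. *)
Definition cross E F : nat :=
  (\sum_P \sum_(i < m P) \sum_(t < m P | t < i) entry F i * entry E t)%N.

Lemma crossDl E E' F : cross (E + E') F = (cross E F + cross E' F)%N.
Proof.
rewrite /cross -big_split; apply: eq_bigr => P _ /=.
rewrite -big_split; apply: eq_bigr => i _ /=.
by rewrite -big_split; apply: eq_bigr => t _; rewrite /entry ffunE mulnDr.
Qed.

Lemma crossDr E F F' : cross E (F + F') = (cross E F + cross E F')%N.
Proof.
rewrite /cross -big_split; apply: eq_bigr => P _ /=.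
rewrite -big_split; apply: eq_bigr => i _ /=.
by rewrite -big_split; apply: eq_bigr => t _; rewrite /entry ffunE mulnDl.
Qed.

Lemma cross_suml I F : cross (\sum_(E <- I) E) F = (\sum_(E <- I) cross E F)%N.
Proof.
elim: I => [|E I IH]; last by rewrite !big_cons crossDl IH.
rewrite !big_nil /cross big1// => P _; rewrite big1// => i _; rewrite big1// => t _.
by rewrite /entry ffunE muln0.
Qed.

Lemma cross_sumr E J : cross E (\sum_(F <- J) F) = (\sum_(F <- J) cross E F)%N.
Proof.
elim: J => [|F J IH]; last by rewrite !big_cons crossDr IH.
rewrite !big_nil /cross big1// => P _; rewrite big1// => i _; rewrite big1// => t _.
by rewrite /entry ffunE.
Qed.

Lemma sigmaE I : sigma I = pairsum cross I.
Proof.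
rewrite -(pairsum_nth (d0 m)) /sigma /cross exchange_big.
apply: eq_bigr => k _; rewrite exchange_big; apply: eq_bigr => l _.
by rewrite /part.
Qed.

Lemma sigma_cat I J : sigma (I ++ J) =
  (sigma I + sigma J + cross (\sum_(E <- I) E)%R (\sum_(F <- J) F)%R)%N.
Proof.
rewrite !sigmaE pairsum_cat; congr (_ + _); rewrite cross_suml.
by apply: eq_bigr => E _; rewrite cross_sumr.
Qed.

Lemma NcoefE (s : seq (data * int)) :
  Ncoef (map fst s) (map snd s) =
    pairsum (fun a b => a.2 * (nD b.1)%:Z - b.2 * (nD a.1)%:Z) s
    - (sigma (map fst s))%:Z.
Proof.
rewrite /Ncoef -(pairsum_nth (d0 m, 0)) size_map; congr (_ - _).
apply: eq_bigr => k _; apply: eq_bigr => l _.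
by rewrite /npart /part !(nth_map (d0 m, 0 : int)).
Qed.

(** The exponent N of the length-two decomposition (x, y), as it appears in the jump formula. *)
Definition Npair (x y : data * int) : int :=
  x.2 * (nD y.1)%:Z - y.2 * (nD x.1)%:Z - (cross x.1 y.1)%:Z.

(** The pairwise contributions to N are biadditive, so those involving [x] depend on the tail only
    through its total data and degree. *)
Lemma Ncoef_cons (x : data * int) (s : seq (data * int)) :
  (forall y, y \in s -> is_data y.1) ->
  Ncoef (map fst (x :: s)) (map snd (x :: s)) =
    Npair x (\sum_(y <- s) y.1, \sum_(y <- s) y.2) + Ncoef (map fst s) (map snd s).
Proof.
move=> H; rewrite !NcoefE (_ : map fst (x :: s) = [:: x.1] ++ map fst s)//.
have {}H E : E \in map fst s -> is_data E by move=> /mapP[y ys ->]; exact: H.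
rewrite sigma_cat (sigmaE [:: _]) /= big_nil big_seq1 big_map /Npair /=.
have [_] := nD_sum H; rewrite !big_map => ->.
rewrite sumrB -mulr_sumr -mulr_suml.
have -> : \sum_(i <- s) Posz (nD i.1) = Posz (\sum_(i <- s) nD i.1)%N.
  by elim: s {H} => [|y s IH]; rewrite ?big_nil// !big_cons IH.
rewrite add0n PoszD; ring.
Qed.

Lemma Ncoef1 (x : data * int) : Ncoef [:: x.1] [:: x.2] = 0.
Proof.
by rewrite (NcoefE [:: x]) sigmaE /= !big_nil.
Qed.

(** * Slopes, excess and one-sided integer parts *)

Section Slopes.
Variables (R : realType) (alpha : forall P : S, 'I_(m P) -> R).

Lemma alphaD_add E F : alphaD alpha (E + F) = alphaD alpha E + alphaD alpha F.
Proof.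
rewrite /alphaD -big_split; apply: eq_bigr => P _ /=.
by rewrite -big_split; apply: eq_bigr => i _; rewrite /entry ffunE natrD mulrDl.
Qed.

(** The argument of the integer part in M. It is also the real degree at which [E] has slope [lam],
    which links the floors on the S-side to the slope conditions on the Q-side. *)
Definition excess (lam : R) E : R := (nD E)%:R * lam - alphaD alpha E.

Lemma excessD lam E F : balanced E -> balanced F ->
  excess lam (E + F) = excess lam E + excess lam F.
Proof. by move=> bE bF; rewrite /excess nD_add// alphaD_add natrD; ring. Qed.

Lemma excess0 lam : excess lam 0 = 0.
Proof.
rewrite /excess nD0 mul0r /alphaD big1 ?subrr// => P _.
by rewrite big1// => i _; rewrite /entry ffunE mul0r.
Qed.

Lemma excess_sum lam I : (forall E, E \in I -> is_data E) ->
  excess lam (\sum_(E <- I) E) = \sum_(E <- I) excess lam E.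
Proof.
elim: I => [|E I IH] H; first by rewrite !big_nil excess0.
have H' F : F \in I -> is_data F by move=> FI; apply: H; rewrite inE FI orbT.
have [bE _] : is_data E by apply: H; rewrite inE eqxx.
by rewrite !big_cons excessD// ?IH//; case: (nD_sum H').
Qed.

(** Clearing the positive denominator turns a slope condition into a bound on the degree; [b = true]
    selects the strict one. *)
Lemma slope_lteif b (x : data * int) lam : is_data x.1 ->
  (slope alpha x < lam ?<= if ~~ b) = (x.2%:~R < excess lam x.1 ?<= if ~~ b).
Proof.
move=> [_ n0]; rewrite /slope /excess.
have n0' : 0 < (nD x.1)%:R :> R by rewrite ltr0n.
case: b => /=.
  by rewrite ltr_pdivrMr// ltrBrDr mulrC.
by rewrite ler_pdivrMr// lerBrDr mulrC.
Qed.

Lemma slope_eq (x : data * int) lam : is_data x.1 ->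
  (slope alpha x == lam) = (x.2%:~R == excess lam x.1).
Proof.
move=> dx; have := slope_lteif false lam dx; have := slope_lteif true lam dx.
by rewrite /= !eq_le => lt ->; rewrite [lam <= _]leNgt lt -leNgt.
Qed.

(* The left limit of [Num.floor] when [b = true].  Throughout, [b = true] marks
   the [lambda -] version of an object, [b = false] the [lambda] version. *)
Definition floorb (b : bool) (y : R) : int :=
  if b then Num.ceil y - 1 else Num.floor y.

(** This adjunction characterises [floorb], so equalities of floors reduce to equivalences of
    inequalities on integers. *)
Lemma le_floorb b y (e : int) : (e <= floorb b y) = (e%:~R < y ?<= if ~~ b).
Proof.
case: b => /=; last by rewrite floor_ge_int.
by rewrite lerBrDr lezD1 -ceil_gt_int.
Qed.

Lemma floorb_eq b c y z :
  (forall e : int, (e%:~R < y ?<= if ~~ b) = (e%:~R < z ?<= if ~~ c)) ->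
  floorb b y = floorb c z.
Proof.
move=> H; have {}H e : (e <= floorb b y) = (e <= floorb c z).
  by rewrite !le_floorb.
by apply/eqP; rewrite eq_le H lexx -H lexx.
Qed.

Lemma floorb_addz b y (d : int) : floorb b (y + d%:~R) = floorb b y + d.
Proof.
have H e : (e <= floorb b (y + d%:~R)) = (e <= floorb b y + d).
  by rewrite -lerBlDr !le_floorb intrB; case: (b) => /=; rewrite ?ltrBlDr ?lerBlDr.
by apply/eqP; rewrite eq_le H lexx -H lexx.
Qed.

Lemma floorb_int b (d : int) : floorb b d%:~R = d - b%:R.
Proof.
case: b; rewrite /floorb /=; first by rewrite intrKceil.
by rewrite intrKfloor subr0.
Qed.

(** Away from the integers the floor is continuous, hence equal to its left limit. *)
Lemma floorb_nint b y : y != (Num.floor y)%:~R -> floorb b y = Num.floor y.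
Proof.
case: b => // ny; apply: (@floorb_eq true false) => e /=.
rewrite lt_neqAle; case: eqP => //= ey; move: ny.
by rewrite -ey intrKfloor eqxx.
Qed.

End Slopes.
End Data.

(** * Jumps of a single term of the S-side *)

(** The adjacent pairs of [s ++ t] are those of [s], the junction at index [p], and those of [t]. *)
Lemma big_ord_cat_cut (V : Type) (idx : V) (op : Monoid.law idx) (T : Type)
    (s t : seq T) p q (F : nat -> V) : size s = p.+1 -> size t = q.+1 ->
  \big[op/idx]_(k < (size (s ++ t)).-1) F k =
    op (\big[op/idx]_(k < p) F k)
      (op (F p) (\big[op/idx]_(k < q) F (p.+1 + k)%N)).
Proof.
move=> sp tq; rewrite size_cat sp tq addSn /= big_split_ord /= big_ord_recl addn0.
by congr (op _ (op _ _)); apply: eq_bigr => i _; rewrite /= /bump /= add1n addnS addSn.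
Qed.

Section Terms.
Variables (S : finType) (m : S -> nat).
Variables (R : realType) (alpha : forall P : S, 'I_(m P) -> R).
Variable (qb : data m -> lser).
Local Notation data := (data m).
Local Notation excess := (excess alpha).
Implicit Types (D E F : data) (I J : seq data).

Definition adjsum I k : nat := (npart I k + npart I k.+1)%N.

(** The factor of a term of S that depends neither on [d] nor on [lam]. *)
Definition weight I : lser :=
  (\prod_(k < (size I).-1) ser (linv_xpow_sub1 (adjsum I k))) * \prod_(E <- I) qb E.

Definition Mside b I lam : int :=
  \sum_(k < (size I).-1)
    (adjsum I k)%:Z * floorb b (excess lam (Defs.prefix I k.+1)).

Definition Sser b D I d lam : lser := xpow (Mprime D I d + Mside b I lam) * weight I.

(* Interpolates between [Mside true] at [c = 0] and [Mside false] at
   [c = (size I).-1]; the increments in [c] give the telescoping sum. *)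
Definition Mmix (c : nat) I lam : int :=
  \sum_(k < (size I).-1)
    (adjsum I k)%:Z * floorb (c <= k)%N (excess lam (Defs.prefix I k.+1)).

Lemma Mmix0 I lam : Mmix 0 I lam = Mside true I lam.
Proof. by []. Qed.

Lemma Mmix_size I lam : Mmix (size I).-1 I lam = Mside false I lam.
Proof. by apply: eq_bigr => k _; rewrite leqNgt ltn_ord. Qed.

(** Every part lies in two adjacent pairs except the first and the last. The sum of [adjsum] is thus
    the correction term of M'. *)
Lemma sum_adjsum I : I != [::] ->
  (\sum_(k < (size I).-1) adjsum I k + npart I 0 + npart I (size I).-1
    = 2 * \sum_(E <- I) nD E)%N.
Proof.
elim: I => //= E [|F I] IH _.
  by rewrite /= big_ord0 big_seq1 /npart /part /=; lia.
have {}IH := IH isT; rewrite big_cons mulnDr -IH big_ord_recl /=.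
under [X in (_ + X + _ + _)%N]eq_bigr do rewrite /bump /= add1n.
have -> : (\sum_(i < size I) adjsum [:: E, F & I] i.+1
  = \sum_(i < size I) adjsum (F :: I) i)%N by [].
by rewrite /adjsum /npart /part /=; lia.
Qed.

(** * Cutting a partition into two consecutive blocks *)

Section Cut.
Variables (I J : seq data) (p q : nat).
Hypotheses (sI : size I = p.+1) (sJ : size J = q.+1).
Hypothesis dI : forall E, E \in I ++ J -> is_data E.

Let dIl E : E \in I -> is_data E.
Proof. by move=> EI; apply: dI; rewrite mem_cat EI. Qed.
Let dIr E : E \in J -> is_data E.
Proof. by move=> EI; apply: dI; rewrite mem_cat EI orbT. Qed.

Lemma adjsum_cat_l k : (k < p)%N -> adjsum (I ++ J) k = adjsum I k.
Proof.
by move=> kp; rewrite /adjsum /npart /part !nth_cat sI !ltnS kp ltnW.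
Qed.

Lemma adjsum_cat_m : adjsum (I ++ J) p = (npart I p + npart J 0)%N.
Proof. by rewrite /adjsum /npart /part !nth_cat sI ltnSn ltnn subnn. Qed.

Lemma adjsum_cat_r k : adjsum (I ++ J) (p.+1 + k) = adjsum J k.
Proof.
rewrite /adjsum /npart /part !nth_cat sI ltnNge leq_addr/= addKn.
by rewrite -addnS ltnNge leq_addr/= addKn.
Qed.

Lemma prefix_cat_l k : (k <= p.+1)%N -> Defs.prefix (I ++ J) k = Defs.prefix I k.
Proof. by move=> kp; rewrite !prefix_sum takel_cat// sI. Qed.

Lemma prefix_cat_m : Defs.prefix (I ++ J) p.+1 = \sum_(E <- I) E.
Proof. by rewrite prefix_cat_l// prefix_sum -sI take_size. Qed.

Lemma prefix_cat_r k :
  Defs.prefix (I ++ J) (p.+1 + k) = \sum_(E <- I) E + Defs.prefix J k.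
Proof.
by rewrite !prefix_sum take_cat sI ltnNge leq_addr/= addKn big_cat.
Qed.

Lemma excess_cat_r lam k : excess lam (Defs.prefix (I ++ J) (p.+1 + k)) =
  excess lam (\sum_(E <- I) E) + excess lam (Defs.prefix J k).
Proof.
rewrite prefix_cat_r excessD//; first by case: (nD_sum dIl).
rewrite prefix_sum; case: (@nD_sum _ _ (take k J)) => // E EJ; apply: dIr.
exact: mem_take EJ.
Qed.

Lemma weight_cat : weight (I ++ J) =
  ser (linv_xpow_sub1 (adjsum (I ++ J) p)) * (weight I * weight J).
Proof.
rewrite /weight.
rewrite (big_ord_cat_cut _ (fun k => ser (linv_xpow_sub1 (adjsum (I ++ J) k))) sI sJ).
rewrite big_cat /= sI sJ /=.
under eq_bigr do rewrite adjsum_cat_l//.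
under [X in _ * (_ * X) * _]eq_bigr do rewrite adjsum_cat_r//.
ring.
Qed.

(** Prefixes inside [I] use the floor. Prefixes reaching past the cut use its left limit, and the
    integer [d] comes out of it. Only the junction depends on [u]: its value is [d] or [d - 1]. *)
Lemma Mmix_cat (u : bool) lam (d : int) : excess lam (\sum_(E <- I) E) = d%:~R ->
  Mmix (p + u) (I ++ J) lam =
    Mside false I lam + (adjsum (I ++ J) p)%:Z * (d - (~~ u)%:R)
    + Mside true J lam + d * \sum_(k < q) (adjsum J k)%:Z.
Proof.
move=> Hd; rewrite /Mmix.
rewrite (big_ord_cat_cut _ (fun k => (adjsum (I ++ J) k)%:Z *
  floorb (p + u <= k)%N (excess lam (Defs.prefix (I ++ J) k.+1))) sI sJ).
rewrite /= -!addrA; congr (_ + _).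
  rewrite /Mside sI; apply: eq_bigr => k _; rewrite adjsum_cat_l// prefix_cat_l//.
    by rewrite leqNgt ltn_addr.
  by rewrite ltnS ltnW.
congr (_ + _).
  rewrite prefix_cat_m Hd floorb_int; congr (_ * (_ - _%:R)).
  by case: (u); rewrite ?addn1 ?addn0 ?ltnn ?leqnn.
rewrite /Mside sJ mulr_sumr -big_split; apply: eq_bigr => k _ /=.
rewrite adjsum_cat_r -addnS excess_cat_r Hd [_%:~R + _]addrC.
have -> : (p + u <= p.+1 + k)%N by case: (u); lia.
by rewrite floorb_addz mulrDr [d * _]mulrC.
Qed.

Lemma Mmix_cat_nint lam :
  excess lam (\sum_(E <- I) E) != (Num.floor (excess lam (\sum_(E <- I) E)))%:~R ->
  Mmix p.+1 (I ++ J) lam = Mmix p (I ++ J) lam.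
Proof.
move=> Hd; rewrite /Mmix; apply: eq_bigr => k _; case: (ltngtP p k) => // pk.
by rewrite -pk prefix_cat_m !floorb_nint.
Qed.

(** The summand of the jump formula attached to the cut [I | J]. It vanishes unless some integer
    degree gives the first block slope [lam]. *)
Definition cut_term d lam : lser :=
  let f := Num.floor (excess lam (\sum_(E <- I) E)) in
  if excess lam (\sum_(E <- I) E) == f%:~R then
    xpow (Npair (\sum_(E <- I) E, f) (\sum_(E <- J) E, d - f)) *
      (Sser false (\sum_(E <- I) E) I f lam * Sser true (\sum_(E <- J) E) J (d - f) lam)
  else 0.

(** At an integer excess the two exponents differ by the junction's [adjsum], so the difference
    carries a factor [x^a - 1] that cancels the junction's denominator. What remains factors over
    the two blocks. *)
Lemma cut_diff D d lam : \sum_(E <- I ++ J) E = D ->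
  (xpow (Mprime D (I ++ J) d + Mmix p.+1 (I ++ J) lam)
   - xpow (Mprime D (I ++ J) d + Mmix p (I ++ J) lam)) * weight (I ++ J) = cut_term d lam.
Proof.
move=> sD; rewrite /cut_term; set f := Num.floor _; case: eqP => [Hf|/eqP Hf]; last first.
  by rewrite Mmix_cat_nint// subrr mul0r.
have := @Mmix_cat true lam f Hf; have := @Mmix_cat false lam f Hf.
rewrite addn0 addn1 => -> -> /=; rewrite subr0.
have nI := sum_adjsum (I := I) ltac:(by case: (I) sI).
have nJ := sum_adjsum (I := J) ltac:(by case: (J) sJ).
have [bI eI] := nD_sum dIl; have [bJ eJ] := nD_sum dIr.
rewrite weight_cat; set a := adjsum (I ++ J) p.
have a0 : (0 < a)%N.
  rewrite /a adjsum_cat_m addn_gt0 /npart /part.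
  by have [|_ ->] := dIl (E := nth (d0 m) I p); rewrite ?mem_nth ?sI.
set A := Mside false I lam; set B := Mside true J lam.
rewrite /Sser -/A -/B.
set W1 := weight I; set W2 := weight J.
(* [e0] is the exponent with the left-limit value [f - 1] at the junction; the other exponent is
   [e0 + a]. *)
set e0 := Mprime D (I ++ J) d +
  (A + Posz a * (f - 1) + B + f * \sum_(k < q) Posz (adjsum J k)).
have -> : Mprime D (I ++ J) d +
    (A + Posz a * f + B + f * \sum_(k < q) Posz (adjsum J k))
   = e0 + a%:Z by rewrite /e0; ring.
(* The [- a] left by [f - 1] supplies the end terms at the cut in the two M' of the blocks;
   [sum_adjsum] evaluates the sum over [J] multiplied by [f]. *)
have Ee : e0 = Npair (\sum_(E <- I) E, f) (\sum_(E <- J) E, d - f)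
   + (Mprime (\sum_(E <- I) E) I f + A) + (Mprime (\sum_(E <- J) E) J (d - f) + B).
  have sIJ : D = \sum_(E <- I) E + \sum_(E <- J) E by rewrite -sD big_cat.
  rewrite /e0 /Npair /Mprime /= sigma_cat sIJ nD_add// eI eJ.
  rewrite size_cat sI sJ /=.
  have -> : npart (I ++ J) (p + q.+1) = npart J q.
    by rewrite /npart /part nth_cat sI addnS -addSn ltnNge leq_addr/= addKn.
  have -> : npart (I ++ J) 0 = npart I 0 by rewrite /npart /part nth_cat sI.
  have Ea : a = (npart I p + npart J 0)%N by exact: adjsum_cat_m.
  move: nI nJ; rewrite sI sJ /= Ea.
  have -> : \sum_(k < q) Posz (adjsum J k) = Posz (\sum_(k < q) adjsum J k)%N.
    by rewrite (big_morph Posz PoszD erefl).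
  set nI := (\sum_(E <- I) nD E)%N; set nJ := (\sum_(E <- J) nD E)%N.
  set sJ' := (\sum_(k < q) adjsum J k)%N => _ HJ.
  have {HJ} HJ : Posz sJ' = 2 * Posz nJ - Posz (npart J 0) - Posz (npart J q) by lia.
  rewrite HJ !PoszD; ring.
rewrite mulrDl -/e0 {}Ee [in LHS]xpowD [xpow (_ + _ + _)]xpowD.
rewrite [xpow (Npair _ _ + _)]xpowD.
have := mul_linv a0; set L := ser _ => HL.
set x1 := xpow _; set x2 := xpow _; set x3 := xpow _; set xa := xpow _.
transitivity ((xa - 1) * L * (x1 * (x2 * W1 * (x3 * W2)))); first by ring.
by rewrite HL mul1r.
Qed.
End Cut.

(** Telescoping [Mmix c] over [c]: each increment is the contribution of one cut, given by
    [cut_diff]. *)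
Lemma Sser_jump D I d lam : is_partition D I ->
  Sser false D I d lam - Sser true D I d lam =
    \sum_(k < (size I).-1) cut_term (take k.+1 I) (drop k.+1 I) d lam.
Proof.
move=> /partitionP[I0 sD HI]; rewrite /Sser -mulrBl -Mmix0 -Mmix_size.
rewrite -(telescope_sumr (fun k => xpow (Mprime D I d + Mmix k I lam)))//.
rewrite big_mkord mulr_suml; apply: eq_bigr => k _.
have kI : (k.+1 < size I)%N by have := ltn_ord k; lia.
have st : size (take k.+1 I) = k.+1 by rewrite size_take kI.
have sd : size (drop k.+1 I) = (size I - k.+2).+1 by rewrite size_drop; lia.
by have H := cut_diff st sd; rewrite cat_take_drop in H; exact: H.
Qed.

Lemma ser_Sterm (Qb : data -> laurent) D d lam I : (forall E, qb E = ser (Qb E)) ->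
  ser (Sterm alpha Qb D d lam I) = Sser false D I d lam.
Proof.
move=> Hq; rewrite /Sterm !ser_lmul !ser_lprod !big_map; congr (_ * (_ * _)).
  rewrite -(big_mkord xpredT (fun k => ser (linv_xpow_sub1 (adjsum I k)))).
  by rewrite /index_iota subn0.
by apply: eq_bigr => E _; rewrite Hq.
Qed.
End Terms.

(** * Finite sums and their jumps *)

Local Open Scope classical_set_scope.

Lemma finite_seqs (T : eqType) (A : set T) n : finite_set A ->
  finite_set [set s : seq T | (size s <= n)%N /\ forall x, x \in s -> A x].
Proof.
move=> fA; elim: n => [|n IH].
  apply: (@sub_finite_set _ _ [set [::]]); last exact: finite_set1.
  by move=> s [/=]; rewrite leqn0 size_eq0 => /eqP ->.
apply: (@sub_finite_set _ _ ([set [::]] `|`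
    (fun x => x.1 :: x.2) @`
      (A `*` [set s : seq T | (size s <= n)%N /\ forall x, x \in s -> A x]))).
  move=> [|x s] [/= sn H]; first by left.
  right; exists (x, s) => //=; split; first by apply: H; rewrite inE eqxx.
  by split=> // y ys; apply: H; rewrite inE ys orbT.
by rewrite finite_setU; split; [exact: finite_set1|exact/finite_image/finite_setX].
Qed.

Lemma finite_intr (R : realType) (a b : R) :
  finite_set [set e : int | a <= e%:~R <= b].
Proof.
apply: (@sub_finite_set _ _
    ((fun k : nat => Num.floor a + k%:Z) @` `I_(`|(Num.ceil b - Num.floor a)%R|%N.+1))).
  move=> e /= /andP[ae eb]; exists `|(e - Num.floor a)%R|%N.
    have : e <= Num.ceil b by rewrite -(ler_int R) (le_trans eb)// ceil_ge.
    have : Num.floor a <= e by rewrite -(ler_int R) (le_trans (floor_le _)).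
    by rewrite /=; lia.
  have : Num.floor a <= e by rewrite -(ler_int R) (le_trans (floor_le _)).
  by rewrite /=; lia.
exact/finite_image/finite_II.
Qed.

Lemma fsum_mull (K : pzRingType) (T : choiceType) (A : set T) (F : T -> K) a :
  finite_set A -> a * \sum_(i \in A) F i = \sum_(i \in A) a * F i.
Proof. by move=> fA; rewrite !fsbig_finite// mulr_sumr. Qed.

Lemma fsum_mulr (K : pzRingType) (T : choiceType) (A : set T) (F : T -> K) a :
  finite_set A -> (\sum_(i \in A) F i) * a = \sum_(i \in A) F i * a.
Proof. by move=> fA; rewrite !fsbig_finite// mulr_suml. Qed.

Lemma fsumrB (K : zmodType) (T : choiceType) (A : set T) (F G : T -> K) :
  finite_set A ->
  \sum_(i \in A) (F i - G i) = \sum_(i \in A) F i - \sum_(i \in A) G i.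
Proof. by move=> fA; rewrite !fsbig_finite//= sumrB. Qed.

Lemma fsum_fiber (K : nmodType) (T U : choiceType) (C : set T) (A : set U)
    (f : T -> U) (F : T -> K) : finite_set C -> finite_set A -> f @` C `<=` A ->
  \sum_(c \in C) F c = \sum_(a \in A) \sum_(c \in C `&` f @^-1` [set a]) F c.
Proof.
move=> fC fA fCA.
under [RHS]eq_fsbigr => a _ do rewrite fsbig_mkcondr.
rewrite exchange_fsbig//; apply: eq_fsbigr => c /set_mem Cc.
have Afc : A (f c) by apply: fCA; exists c.
rewrite (fsbigD1 (f c))//= ifT; last by apply/mem_set.
rewrite fsbig1 ?addr0// => a [/= _ /eqP afc].
by case: ifPn => // /set_mem /= e; rewrite e eqxx in afc.
Qed.

Section Sums.
Variables (S : finType) (m : S -> nat).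
Variables (R : realType) (alpha : forall P : S, 'I_(m P) -> R).
Variables (q : data m -> int -> lser) (qb : data m -> lser).
Local Notation data := (data m).
Local Notation excess := (excess alpha).
Implicit Types (D E F : data) (I J : seq data) (s : seq (data * int)).

(** * Finiteness of the index sets *)

Lemma not_data0 : ~ is_data (0 : data).
Proof. by case=> _; rewrite nD0. Qed.

Definition below D : set data := [set E | forall j, (E j <= D j)%N].

Lemma finite_below D : finite_set (below D).
Proof.
pose n := (\sum_j D j)%N.
apply: (@sub_finite_set _ _
  (range (fun f : {ffun idx m -> 'I_n.+1} => [ffun j => f j : nat]))).
  move=> E ED; exists [ffun j => inord (E j)] => //.
  apply/ffunP => j; rewrite !ffunE inordK// ltnS (leq_trans (ED j))//.
  by rewrite /n (bigD1 j)//= leq_addr.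
exact/finite_image/finite_finset.
Qed.

Lemma below_add E F : below (E + F) E.
Proof. by move=> j; rewrite ffunE leq_addr. Qed.

Lemma below_mem E I : E \in I -> below (\sum_(F <- I) F) E.
Proof.
elim: I => // F I IH; rewrite inE big_cons => /orP[/eqP ->|/IH H j].
  exact: below_add.
by rewrite ffunE (leq_trans (H j)) ?leq_addl.
Qed.

Definition parts D : set (seq data) := [set I | is_partition D I].

(** A finite set containing all partitions of [D]: each part has positive n, so n(D) bounds the
    length. *)
Definition seqs_below D : set (seq data) :=
  [set I | (size I <= nD D)%N /\ forall E, E \in I -> below D E].

Lemma finite_seqs_below D : finite_set (seqs_below D).
Proof. exact/finite_seqs/finite_below. Qed.

Lemma partition_size D I : is_partition D I -> (size I <= nD D)%N.
Proof.
move=> pI; rewrite (partition_nD pI); case/partitionP: pI => _ _.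
elim: I => // E I IH H; rewrite big_cons /= -add1n leq_add//.
  by have [] : is_data E by apply: H; rewrite inE eqxx.
by apply: IH => F FI; apply: H; rewrite inE FI orbT.
Qed.

Lemma parts_sub D : parts D `<=` seqs_below D.
Proof.
move=> I pI; split; first exact: partition_size.
by case/partitionP: pI => _ <- _ E; exact: below_mem.
Qed.

Lemma finite_parts D : finite_set (parts D).
Proof. exact/(sub_finite_set (@parts_sub D))/finite_seqs_below. Qed.

Lemma decompP D d s : decomp alpha D d s <->
  [/\ s != [::], (\sum_(x <- s) x.1, \sum_(x <- s) x.2) = (D, d),
      forall x, x \in s -> is_data x.1
    & sorted (fun a b => b < a) (map (slope alpha) s)].
Proof.
rewrite /decomp; split.
  move=> [/partitionP[s0 sD H] <- so]; split=> //.
  - by case: (s) s0.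
  - by rewrite -sD big_map.
  - by move=> x xs; apply: H; exact: map_f.
move=> [s0 [sD sd] H so]; split=> //; apply/partitionP; split.
- by case: (s) s0.
- by rewrite big_map.
- by move=> E /mapP[x xs ->]; exact: H.
Qed.

Definition decomps b D d lam : set (seq (data * int)) :=
  [set s | decomp alpha D d s /\
     slope alpha (head (d0 m, 0) s) < lam ?<= if ~~ b].

(** Slopes decrease along [s], so the bound on the first one holds for all. *)
Lemma decomps_le b D d lam s : decomps b D d lam s ->
  forall x, x \in s -> x.2%:~R <= excess lam x.1.
Proof.
move=> [/decompP[s0 _ Hd so] hs] x xs.
have := slope_lteif alpha false lam (Hd _ xs) => /= <-.
case: s s0 so hs xs {Hd} => // y s _ /= so hs.
have {}hs : slope alpha y <= lam by case: (b) hs => //= /ltW.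
rewrite inE => /orP[/eqP -> //|xs].
apply: le_trans hs; apply: ltW; have := order_path_min _ so.
by move=> /(_ (fun y x z xy yz => lt_trans yz xy)) /allP; apply; exact: map_f.
Qed.

Lemma decomp_excess D d s lam : decomp alpha D d s ->
  \sum_(x <- s) (excess lam x.1 - x.2%:~R) = excess lam D - d%:~R.
Proof.
move=> /decompP[_ [sD sd] Hd _]; rewrite sumrB -sd -sD.
rewrite (big_morph intr (@intrD _) erefl); congr (_ - _).
have {}Hd E : E \in map fst s -> is_data E by move=> /mapP[x xs ->]; exact: Hd.
by have := excess_sum alpha lam Hd; rewrite !big_map.
Qed.

(** The gaps between excess and degree are non-negative and have a fixed sum, so none exceeds the
    total. With [decomps_le] this confines the degrees to bounded intervals. *)
Lemma decomps_ge b D d lam s : decomps b D d lam s ->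
  forall x, x \in s -> excess lam x.1 - (excess lam D - d%:~R) <= x.2%:~R.
Proof.
move=> hs x xs; rewrite lerBlDr -lerBlDl -(decomp_excess lam hs.1) (big_rem x)//=.
rewrite lerDl big_seq sumr_ge0// => y /mem_rem ys; rewrite subr_ge0.
exact: decomps_le hs _ ys.
Qed.

Lemma finite_decomps b D d lam : finite_set (decomps b D d lam).
Proof.
set A := below D `*`` (fun E => [set e : int |
   excess lam E - (excess lam D - d%:~R) <= e%:~R <= excess lam E]).
apply: (@sub_finite_set _ _ [set s | (size s <= nD D)%N /\ forall x, x \in s -> A x]).
  move=> s hs; have [pD _ _] := hs.1; split.
    by rewrite -(size_map fst s); exact: partition_size.
  move=> x xs; split=> /=; last by rewrite (decomps_ge hs)// (decomps_le hs).
  by have [_ H] := parts_sub pD; apply: H; exact: map_f.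
apply: finite_seqs; apply: finite_setXR; first exact: finite_below.
by move=> E _; exact: finite_intr.
Qed.

Definition Qser s : lser :=
  xpow (Ncoef (map fst s) (map snd s)) * \prod_(x <- s) q x.1 x.2.

(** For [b = false] these are the two sides of the theorem; for [b = true], their left limits in
    [lam]. *)
Definition Qsum b D d lam : lser := \sum_(s \in decomps b D d lam) Qser s.
Definition Ssum b D d lam : lser := \sum_(I \in parts D) Sser alpha qb b D I d lam.

(* The index set of the common jump formula: all ways to split off (R1, d1) of
   slope exactly [lam] from (D, d). *)
Definition splits D d lam : set ((data * int) * (data * int)) :=
  [set a | [/\ is_data a.1.1, is_data a.2.1,
               (a.1.1 + a.2.1, a.1.2 + a.2.2) = (D, d)
             & a.1.2%:~R = excess lam a.1.1]].

Lemma finite_splits D d lam : finite_set (splits D d lam).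
Proof.
apply: (@sub_finite_set _ _ ((fun EF : data * data =>
    ((EF.1, Num.floor (excess lam EF.1)), (EF.2, d - Num.floor (excess lam EF.1))))
    @` (below D `*` below D))).
  move=> [[E e] [F f]] [/= _ _ [<- <-] He]; exists (E, F) => /=.
    by split; [exact: below_add|rewrite addrC; exact: below_add].
  by rewrite -He intrKfloor addrAC subrr add0r.
by apply: finite_image; apply: finite_setX; exact: finite_below.
Qed.

(** * The jump formula on both sides *)

Lemma Qser_cons x s : (forall y, y \in s -> is_data y.1) ->
  Qser (x :: s) = xpow (Npair x (\sum_(y <- s) y.1, \sum_(y <- s) y.2))
    * (q x.1 x.2 * Qser s).
Proof. by move=> H; rewrite /Qser Ncoef_cons// xpowD big_cons; ring. Qed.

(** The difference collects the decompositions whose first slope is exactly [lam]. Grouping them by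
    first part and total of the rest leaves, as tails, all decompositions with slopes below
    [lam]. *)
Lemma Qsum_jump D d lam : slope alpha (D, d) < lam ->
  Qsum false D d lam - Qsum true D d lam =
    \sum_(a \in splits D d lam)
       xpow (Npair a.1 a.2) * (q a.1.1 a.1.2 * Qsum true a.2.1 a.2.2 lam).
Proof.
move=> sl; rewrite {1}/Qsum (fsbigID (decomps true D d lam)); last exact: finite_decomps.
have -> : decomps false D d lam `&` decomps true D d lam = decomps true D d lam.
  by apply/seteqP; split=> s [] // H1 H2; split=> //; split=> //=; exact: ltW.
rewrite addrC addKr.
set Hd := _ `&` _.
pose f s : (data * int) * (data * int) :=
  (head (d0 m, 0) s, (\sum_(y <- behead s) y.1, \sum_(y <- behead s) y.2)).
have HdE s : Hd s <-> decomp alpha D d s /\ slope alpha (head (d0 m, 0) s) = lam.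
  split=> [[[H1 /= H2] H3]|[H1 H2]].
    split=> //; apply/eqP; rewrite eq_le H2 /= leNgt; apply/negP => H4.
    by apply: H3; split.
  by split; [split=> //=; rewrite H2|move=> [_ /=]; rewrite H2 ltxx].
rewrite (@fsum_fiber _ _ _ Hd (splits D d lam) f)//; first last.
- move=> _ [s /HdE[/decompP[s0 sDd Hs so] sls] <-].
  case: s s0 sDd Hs so sls => // x s _; rewrite !big_cons /= => sDd Hs so sls.
  (* A single part would be (D, d) itself, whose slope is strictly below [lam]. *)
  have s0 : s != [::].
    apply/eqP => s0; move: sl; rewrite -sDd s0 !big_nil !addr0 -surjective_pairing.
    by rewrite sls ltxx.
  have dx : is_data x.1 by apply: Hs; rewrite inE eqxx.
  split=> //=; last by apply/eqP; rewrite -slope_eq// sls.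
  rewrite -(big_map fst xpredT id); apply: is_data_sum; first by case: (s) s0.
  by move=> E /mapP[y ys ->]; apply: Hs; rewrite inE ys orbT.
- exact: finite_splits.
- by apply: finite_setIl; exact: finite_decomps.
apply: eq_fsbigr => a /set_mem[d1 d2 sa ea].
(* The strict bound on the tail's first slope is the same as sortedness after prepending [a.1], of
   slope [lam]. *)
have -> : Hd `&` f @^-1` [set a] = cons a.1 @` decomps true a.2.1 a.2.2 lam.
  apply/seteqP; split=> [s [/HdE[/decompP[s0 sDd Hs so] sls] /= fs]|
                         _ [s [/decompP[s0 sDd Hs so] /= sls] <-]].
    case: s s0 sDd Hs so sls fs => // x s _ _ Hs so sls; rewrite /f /= => fs.
    rewrite -fs /=; exists s => //; split.
      apply/decompP; split=> //; last exact: path_sorted so.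
        apply/eqP => s0; move: d2; rewrite -fs s0 /= big_nil => d2.
        by case: (not_data0 d2).
      by move=> y ys; apply: Hs; rewrite inE ys orbT.
    case: (s) so fs => [_ fs|y s' /= /andP[]]; last by rewrite sls.
    by move: d2; rewrite -fs /= big_nil => d2; case: (not_data0 d2).
  have sl1 : slope alpha a.1 = lam by apply/eqP; rewrite slope_eq// ea.
  split; last first.
    by rewrite /f /= sDd -!surjective_pairing.
  apply/HdE; split=> //; apply/decompP; split=> //.
  - by rewrite !big_cons -sa; case: sDd => -> ->.
  - by move=> x; rewrite inE => /orP[/eqP ->//|]; exact: Hs.
  - by case: (s) s0 so sls => //= y s' _ -> ; rewrite sl1 => ->.
rewrite fsbig_image; last by move=> s t _ _ [].
rewrite /Qsum !fsum_mull; try exact: finite_decomps.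
apply: eq_fsbigr => s /set_mem[/decompP[_ sDd Hs _] _].
by rewrite Qser_cons// sDd -surjective_pairing.
Qed.

(** At its own slope (D, d) has zero total gap, so every part has slope [lam]; strict decrease then
    allows only one part. *)
Lemma Qsum_slope D d lam : is_data D -> slope alpha (D, d) = lam ->
  Qsum false D d lam = q D d.
Proof.
move=> dD sl; rewrite /Qsum.
have eD : excess lam D - d%:~R = 0.
  by apply/eqP; rewrite subr_eq0 eq_sym -(@slope_eq _ _ _ _ (D, d))// sl.
have -> : decomps false D d lam = [set [:: (D, d)]].
  apply/seteqP; split=> [s hs|_ ->]; last first.
    split; last by rewrite /= sl.
    by apply/decompP; rewrite !big_seq1; split=> // x; rewrite inE => /eqP ->.
  have Hx x : x \in s -> slope alpha x = lam.
    move=> xs; have := decomps_ge hs xs; rewrite eD subr0 => h1.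
    have [/decompP[_ _ Hd _] _] := hs; apply/eqP.
    by rewrite slope_eq; [rewrite eq_le h1 (decomps_le hs)|exact: Hd].
  have [/decompP[s0 sDd _ so] _] := hs; case: s s0 sDd so Hx {hs} => // x [|y s] _ + + Hx.
    by rewrite !big_seq1 -surjective_pairing => ->.
  move=> _ /= /andP[+ _].
  by rewrite (Hx x) ?(Hx y) ?ltxx// !inE eqxx ?orbT.
rewrite fsbig_set1 /Qser big_seq1 /= (Ncoef1 (D, d)) xpow0 mul1r//.
Qed.

(** Both sides are the sum of [cut_term] over the set [C] of partitions with a marked cut of integer
    excess: fibred over the concatenation it gives the jumps of the single terms, fibred over the
    sums of the two blocks it gives the products. *)
Lemma Ssum_jump D d lam : 
  Ssum false D d lam - Ssum true D d lam =
    \sum_(a \in splits D d lam)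
       xpow (Npair a.1 a.2) * (Ssum false a.1.1 a.1.2 lam * Ssum true a.2.1 a.2.2 lam).
Proof.
pose C : set (seq data * seq data) := [set c | [/\ c.1 != [::], c.2 != [::],
  is_partition D (c.1 ++ c.2) & excess lam (\sum_(E <- c.1) E) ==
    (Num.floor (excess lam (\sum_(E <- c.1) E)))%:~R]].
pose F (c : seq data * seq data) := cut_term alpha qb c.1 c.2 d lam.
have fC : finite_set C.
  apply: (@sub_finite_set _ _ (seqs_below D `*` seqs_below D)).
    move=> [I J] [/= _ _ pIJ _]; have [sIJ H] := parts_sub pIJ.
    rewrite size_cat in sIJ; split=> /=.
      split; first by rewrite (leq_trans _ sIJ) ?leq_addr.
      by move=> E EI; apply: H; rewrite mem_cat EI.
    split; first by rewrite (leq_trans _ sIJ) ?leq_addl.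
    by move=> E EI; apply: H; rewrite mem_cat EI orbT.
  by apply: finite_setX; exact: finite_seqs_below.
transitivity (\sum_(c \in C) F c).
  rewrite (@fsum_fiber _ _ _ C (parts D) (fun c => c.1 ++ c.2))//; first last.
  - by move=> _ [c [_ _ pc _] <-].
  - exact: finite_parts.
  transitivity (\sum_(I \in parts D)
      (Sser alpha qb false D I d lam - Sser alpha qb true D I d lam)).
    by apply/esym/fsumrB; exact: finite_parts.
  apply: eq_fsbigr => I /set_mem pI.
  rewrite Sser_jump//.
  pose g k := (take k.+1 I, drop k.+1 I).
  rewrite -(big_mkord xpredT (fun k => F (g k))) -(big_map g xpredT F).
  have [I0 _ HI] := (partitionP _ _).1 pI.
  rewrite fsbig_seq; last first.
    rewrite map_inj_in_uniq ?iota_uniq// => i j; rewrite !mem_index_iota /g /= => hi hj.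
    move=> [/(congr1 size) + _]; rewrite !size_takel => [[]//||];
      [exact: leq_trans hj (leq_pred _)|exact: leq_trans hi (leq_pred _)].
  (* Cuts of non-integer excess lie outside [C], but their [cut_term] is 0. *)
  apply/esym/fsbig_widen.
    move=> [I1 J1] [[/= I10 J10 pIJ _] IJ].
    apply/mapP; exists (size I1).-1.
      rewrite mem_index_iota -IJ size_cat.
      move: I10 J10; rewrite -!size_eq0 -!lt0n; move: (size I1) (size J1); lia.
    by rewrite /g -IJ prednK ?take_size_cat ?drop_size_cat// lt0n size_eq0.
  move=> _ [/= /mapP[k + ->] H]; rewrite mem_index_iota => /= kI.
  rewrite /F /cut_term; case: ifP => // He; exfalso; apply: H; split; last first.
    by rewrite /g /= cat_take_drop.
  split=> //; rewrite /g /= ?cat_take_drop//.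
    by rewrite -size_eq0 size_takel// (leq_trans kI) ?leq_pred.
  by rewrite -size_eq0 -lt0n size_drop subn_gt0; move: kI; case: (size I).
pose h (c : seq data * seq data) :=
  let e := Num.floor (excess lam (\sum_(E <- c.1) E)) in
  ((\sum_(E <- c.1) E, e), (\sum_(E <- c.2) E, d - e)).
have HC c : C c ->
    (forall E, E \in c.1 -> is_data E) /\ (forall E, E \in c.2 -> is_data E).
  move=> [_ _ /partitionP[_ _ H] _].
  by split=> E Ec; apply: H; rewrite mem_cat Ec ?orbT.
rewrite (@fsum_fiber _ _ _ C (splits D d lam) h)//; first last.
- move=> _ [c Cc <-]; have [H1 H2] := HC _ Cc.
  have [I0 J0 /partitionP[_ sD _] /eqP He] := Cc; split=> //=.
  + exact: is_data_sum.
  + exact: is_data_sum.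
  + by rewrite -sD big_cat addrCA subrr addr0.
- exact: finite_splits.
apply: eq_fsbigr => a /set_mem[d1 d2 sa ea].
(* With the block sums fixed, the two blocks are arbitrary independent partitions of them. *)
have -> : C `&` h @^-1` [set a] = parts a.1.1 `*` parts a.2.1.
  apply/seteqP; split=> [c [Cc /= <-]|c [/= p1 p2]].
    have [H1 H2] := HC _ Cc; have [I0 J0 _ _] := Cc.
    by split; apply/partitionP; split.
  have /partitionP[I0 s1 H1] := p1; have /partitionP[J0 s2 H2] := p2.
  split; last first.
    rewrite /= /h s1 s2 -ea intrKfloor.
    by case: sa => _ <-; rewrite addrAC subrr add0r -!surjective_pairing.
  split=> //; last by rewrite s1 -ea intrKfloor.
  apply/partitionP; split.
  + by case: (c.1) I0.
  + by case: sa => <- _; rewrite big_cat s1 s2.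
  + by move=> E; rewrite mem_cat => /orP[]; [exact: H1|exact: H2].
have fP E := @finite_parts E.
rewrite /Ssum (fsum_mulr _ _ (fP _)) (fsum_mull _ _ (fP _)).
under [RHS]eq_fsbigr => I _ do
  rewrite (fsum_mull _ _ (fP _)) (fsum_mull _ _ (fP _)).
rewrite (pair_fsbig _ _ (fP _) (fP _)); apply: eq_fsbigr => c /set_mem[/= p1 p2].
have /partitionP[I0 s1 H1] := p1; have /partitionP[J0 s2 H2] := p2.
rewrite /F /cut_term s1 s2 -ea intrKfloor eqxx.
by case: sa => _ <-; rewrite addrAC subrr add0r -!surjective_pairing.
Qed.

End Sums.

(** * Comparison of the two sides *)

Local Open Scope classical_set_scope.

Lemma eventually_all (R : realType) (T : eqType) (s : seq T) (P : T -> R -> Prop) :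
  (forall i, i \in s -> exists L, forall mu, L <= mu -> P i mu) ->
  exists L, forall mu, L <= mu -> forall i, i \in s -> P i mu.
Proof.
elim: s => [|i s IH] H; first by exists 0.
have [L1 H1] : exists L, forall mu, L <= mu -> P i mu by apply: H; rewrite inE eqxx.
have [L2 H2] : exists L, forall mu, L <= mu -> forall j, j \in s -> P j mu.
  by apply: IH => j js; apply: H; rewrite inE js orbT.
exists (Num.max L1 L2) => mu; rewrite ge_max => /andP[h1 h2] j.
by rewrite inE => /orP[/eqP ->|]; [exact: H1|exact: H2].
Qed.

(* Bisecting at the points of [jumps] avoids having to sort them. *)
Lemma descent (R : realType) (T : Type) (jumps : set R) (F G : R -> T) :
  (forall a b, a < b -> (forall x, jumps x -> ~~ (a < x < b)) -> G b = F a) ->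
  forall (s : seq R) a b, a <= b ->
  (forall x, jumps x -> a < x < b -> x \in s) ->
  (forall x, a < x <= b -> F x = G x) -> F a = F b.
Proof.
move=> FG s; move: {2}(size s) (leqnn (size s)) => n.
elim: n s => [|n IH] s sn a b; rewrite le_eqVlt => /orP[/eqP ->//|ab] Hs H.
  move: sn; rewrite leqn0 size_eq0 => /eqP s0; rewrite (H b) ?ab ?lexx//.
  by apply/esym/FG => // x Jx; apply/negP => /(Hs _ Jx); rewrite s0.
have [[x [Jx xab]]|nx] := pselect (exists x, jumps x /\ a < x < b); last first.
  rewrite (H b) ?ab ?lexx//; apply/esym/FG => // x Jx; apply/negP => xab.
  by apply: nx; exists x.
have xs := Hs x Jx xab; have /andP[ax xb] := xab.
have sr : (size [seq y <- s | y != x] <= n)%N.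
  rewrite -ltnS (leq_trans _ sn)// size_filter ltn_neqAle count_size andbT.
  rewrite -all_count; apply/negP => /allP /(_ x xs); by rewrite eqxx.
transitivity (F x).
  apply: (IH _ sr) => //; first exact: ltW.
    move=> y Jy /andP[ay yx]; rewrite mem_filter (lt_eqF yx)/= Hs// ay.
    exact: lt_trans xb.
  by move=> y /andP[ay yx]; rewrite H// ay (le_trans yx)// ltW.
apply: (IH _ sr) => //; first exact: ltW.
  move=> y Jy /andP[xy yb]; rewrite mem_filter (gt_eqF xy)/= Hs// yb andbT.
  exact: lt_trans xy.
by move=> y /andP[xy yb]; rewrite H// yb (lt_trans ax).
Qed.

Lemma coefs_fsum (T : choiceType) (A : set T) (F : T -> lser) n :
  finite_set A -> coefs n (\sum_(i \in A) F i) = \sum_(i \in A) coefs n (F i).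
Proof. by move=> fA; rewrite !fsbig_finite// raddf_sum. Qed.

Lemma HasSum_finite (T : choiceType) (P : set T) (F : T -> laurent) L :
  finite_set P -> ser L = \sum_(i \in P) ser (F i) -> HasSum P F L.
Proof.
move=> fP HL; split.
  (* A uniform lower bound for the finitely many [lval (F i)]. *)
  exists (- \sum_(i <- fset_set P) `|lval (F i)|) => i Pi n hn.
  apply: lcoefZ_lt; apply: (lt_le_trans hn).
  have iP : i \in (fset_set P : seq T) by rewrite in_fset_set//; apply/mem_set.
  rewrite lerNl (le_trans (ler_norm _))// normrN (big_rem i)//= lerDl.
  by rewrite sumr_ge0.
move=> n; exists (fset_set P); split.
- exact: finmap.fset_uniq.
- by move=> i; rewrite in_fset_set// => /set_mem.
- by move=> i Pi _; rewrite in_fset_set//; apply/mem_set.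
- rewrite -[LHS]/(coefs n (ser L)) HL coefs_fsum// fsbig_finite//.
Qed.

Section Main.
Variables (S : finType) (m : S -> nat).
Variables (R : realType) (alpha : forall P : S, 'I_(m P) -> R).
Variables (Q : data m -> int -> laurent) (Qb : data m -> laurent).
Hypothesis hQ : forall (D : data m) (d : int), is_data D ->
  HasSum (decomp alpha D d) (Qterm Q) (Qb D).
Local Notation data := (data m).
Local Notation excess := (excess alpha).
Local Notation q := (fun D d => ser (Q D d)).
Local Notation qb := (fun D => ser (Qb D)).
Local Notation Qsum := (Qsum alpha q).
Local Notation Ssum := (Ssum alpha qb).
Implicit Types (D E F : data) (I J : seq data) (s : seq (data * int)).

(** * Limits for lambda tending to infinity *)

Lemma ser_Qterm s : ser (Qterm Q s) = Qser q s.
Proof. by rewrite /Qterm ser_lmul ser_lprod big_map. Qed.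

Lemma Qsum_limit D d n : is_data D ->
  exists L, forall mu, L <= mu -> coefs n (Qsum false D d mu) = coefs n (qb D).
Proof.
move=> dD; have [_ /(_ n)[s [us Ps Hs sn]]] := hQ d dD.
have [s0|L HL] := @eventually_all R _ s
  (fun i mu => slope alpha (head (d0 m, 0) i) <= mu).
  by exists (slope alpha (head (d0 m, 0) s0)).
exists L => mu Lmu; rewrite coefs_fsum; last exact: finite_decomps.
rewrite -[RHS]/(lcoefZ (Qb D) n) sn.
have E i : lcoefZ (Qterm Q i) n = coefs n (Qser q i) by rewrite -ser_Qterm.
under [RHS]eq_bigr do rewrite E.
rewrite [RHS]fsbig_seq//.
apply/esym/fsbig_widen => [i /= is_|i [[Di _] nis] /=].
  by split; [exact: Ps|exact: HL].
by apply/eqP; rewrite -E; apply: contra_notT nis => /(Hs _ Di).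
Qed.

Lemma prefix_data D I k : is_partition D I -> (k < size I)%N ->
  is_data (Defs.prefix I k.+1) /\ below D (Defs.prefix I k.+1).
Proof.
move=> /partitionP[I0 <- HI] kI; rewrite prefix_sum; split.
  apply: is_data_sum; first by rewrite -size_eq0 size_takel.
  by move=> E /mem_take; exact: HI.
by rewrite -{1}(cat_take_drop k.+1 I) big_cat; exact: below_add.
Qed.

Lemma Mside_limit D I (K : nat) : is_partition D I -> (1 < size I)%N ->
  exists L, forall mu, L <= mu -> K%:Z <= Mside alpha false I mu.
Proof.
move=> pI I1.
have [k|L HL] := @eventually_all R _ (iota 0 (size I).-1)
  (fun k mu => K%:R <= excess mu (Defs.prefix I k.+1)).
  rewrite mem_iota add0n => /= kI.
  have [|[_ n0] _] := prefix_data (k := k) pI; first by rewrite (leq_trans kI) ?leq_pred.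
  set E := Defs.prefix _ _ in n0 *.
  (* Since [nD E] is at least 1 and [mu] is non-negative, [nD E * mu] is at least [mu]. *)
  exists (K%:R + `|alphaD alpha E|) => mu Hmu.
  rewrite -[leRHS]/((nD E)%:R * mu - alphaD alpha E) lerBrDr.
  have h1 : 0 <= mu by rewrite (le_trans _ Hmu)// addr_ge0.
  apply: le_trans (_ : mu <= _); last by rewrite ler_peMl// ler1n.
  by rewrite (le_trans _ Hmu)// lerD2l ler_norm.
exists L => mu Lmu; have {}HL k : (k < (size I).-1)%N ->
    K%:Z <= (adjsum I k)%:Z * floorb false (excess mu (Defs.prefix I k.+1)).
  move=> kI; have : K%:Z <= floorb false (excess mu (Defs.prefix I k.+1)).
    by rewrite le_floorb /= HL// mem_iota.
  have : (0 < adjsum I k)%N.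
    have [_ _ HI] := (partitionP _ _).1 pI.
    have [|_] := HI (nth (d0 m) I k); first by rewrite mem_nth// (leq_trans kI) ?leq_pred.
    by rewrite /adjsum /npart /part addn_gt0 => ->.
  move: (floorb _ _) (adjsum I k) => f a a0 Kf.
  by apply: (le_trans Kf); rewrite ler_peMl//; lia.
rewrite /Mside; case: (size I) I1 HL => [//|[//|r]] _ /= HL.
rewrite big_ord_recl -[leLHS]addr0; apply: lerD; first exact: HL.
by apply: sumr_ge0 => k _; apply: le_trans (HL _ _) => //=; rewrite /bump /= add1n ltnS.
Qed.

Lemma Sser_single b D d lam : Sser alpha qb b D [:: D] d lam = qb D.
Proof.
have s0 : sigma [:: D] = 0%N by rewrite sigmaE /= big_nil.
have M0 : Mprime D [:: D] d = 0 by rewrite /Mprime s0 /npart /part /=; ring.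
by rewrite /Sser M0 /Mside /weight /= !big_ord0 big_seq1 addr0 xpow0 !mul1r.
Qed.

Lemma partition_single D I : is_partition D I -> (size I <= 1)%N -> I = [:: D].
Proof. by move=> /partitionP[]; case: I => [//|E [|//]] _; rewrite big_seq1 => ->. Qed.

(** The exponent of every term of length at least 2 tends to infinity, so only the partition
    [[:: D]] still reaches the coefficient of [x^n]. *)
Lemma Ssum_limit D d n : is_data D ->
  exists L, forall mu, L <= mu -> coefs n (Ssum false D d mu) = coefs n (qb D).
Proof.
move=> dD; have fP := @finite_parts _ _ D.
have [I|L HL] := @eventually_all R _ (fset_set (parts D))
  (fun I mu => (1 < size I)%N -> coefs n (Sser alpha qb false D I d mu) = 0).
  rewrite in_fset_set// => /set_mem pI.
  have [I1|I1] := leqP (size I) 1; first by exists 0.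
  have [v Hv] := coef_lt (weight qb I).
  (* This bound pushes [n] minus the exponent below the order [v] of the weight. *)
  have [L HL] := Mside_limit `|(n - v - Mprime D I d)%R|%N.+1 pI I1.
  exists L => mu Lmu _; rewrite /Sser coef_xpowM; apply: Hv.
  by have := HL _ Lmu; lia.
exists L => mu Lmu; rewrite coefs_fsum// (fsbigD1 [:: D])//=; last first.
  apply/partitionP; rewrite big_seq1; split=> // E; by rewrite inE => /eqP ->.
rewrite Sser_single fsbig1 ?addr0// => I [pI nI]; apply: (HL _ Lmu).
  by rewrite in_fset_set//; apply/mem_set.
by rewrite ltnNge; apply/negP => /(partition_single pI).
Qed.

(** All values of lambda at which a slope condition or an integer part occurring for [D] can
    change. *)
Definition jumps D : set R :=
  [set slope alpha x | x in [set x : data * int | is_data x.1 /\ below D x.1]].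

Lemma finite_jumps D a b : finite_set (jumps D `&` [set x | a < x < b]).
Proof.
pose A := below D `*`` (fun E => [set e : int | excess a E <= e%:~R <= excess b E]).
apply: (@sub_finite_set _ _ (slope alpha @` A)).
  move=> _ [[x [dx bx] <-] /= /andP[ax xb]]; exists x => //; split=> //=.
  have := slope_lteif alpha false b dx; rewrite /= (ltW xb) => <-; rewrite andbT.
  have := slope_lteif alpha true a dx; rewrite /= => h.
  by rewrite leNgt -h -leNgt ltW.
apply: finite_image; apply: finite_setXR; first exact: finite_below.
by move=> E _; exact: finite_intr.
Qed.

Lemma nojump_eq D a b x : a < b -> (forall y, jumps D y -> ~~ (a < y < b)) ->
  is_data x.1 -> below D x.1 -> (slope alpha x < b) = (slope alpha x <= a).
Proof.
move=> ab H dx bx; apply/idP/idP => [xb|xa]; last exact: le_lt_trans ab.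
have := H (slope alpha x); rewrite xb andbT leNgt; apply.
by exists x.
Qed.

Lemma Qsum_nojump D d a b : a < b -> (forall y, jumps D y -> ~~ (a < y < b)) ->
  Qsum true D d b = Qsum false D d a.
Proof.
move=> ab H; rewrite /Qsum; congr (\sum_(s \in _) _); apply/seteqP.
have E s : decomp alpha D d s ->
    (slope alpha (head (d0 m, 0) s) < b) = (slope alpha (head (d0 m, 0) s) <= a).
  move=> /decompP[s0 [sD _] Hs _].
  have hs : head (d0 m, 0) s \in s by case: (s) s0 => // x s' _; rewrite inE eqxx.
  apply: nojump_eq ab H _ _; first exact: Hs.
  by rewrite -sD -(big_map fst xpredT id); apply: below_mem; exact: map_f.
by split=> s [Ds /=]; [rewrite E|rewrite -E] => // hs; split.
Qed.

(** Floors of a prefix [E] are compared through the integers [e] below them, that is, through the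
    slopes of the pairs [(E, e)], which all lie in [jumps D]. *)
Lemma Ssum_nojump D d a b : a < b -> (forall y, jumps D y -> ~~ (a < y < b)) ->
  Ssum true D d b = Ssum false D d a.
Proof.
move=> ab H; apply: eq_fsbigr => I /set_mem pI; rewrite /Sser; congr (xpow (_ + _) * _).
apply: eq_bigr => k _; congr (_ * _).
have [|dE bE] := prefix_data (k := k) pI.
  by rewrite (leq_trans (ltn_ord k)) ?leq_pred.
set E := Defs.prefix _ _ in dE bE *.
apply: floorb_eq => e.
by rewrite -!(@slope_lteif _ _ _ _ _ (E, e))//=; exact: nojump_eq ab H _ _.
Qed.

(** Strong induction on [nD D]: the jumps agree by induction, and descent from large [lam],
    coefficient by coefficient, transfers equality of the limits. Both values of [b] are needed
    because the jump formula mixes them. *)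
Lemma Qsum_eq_Ssum D : is_data D -> forall d lam b,
  slope alpha (D, d) < lam ?<= if ~~ b -> Qsum b D d lam = Ssum b D d lam.
Proof.
move: {2}(nD D) (leqnn (nD D)) => N; elim: N D => [|N IH] D.
  by rewrite leqn0 => /eqP D0 [_]; rewrite D0.
move=> DN dD d.
have jump lam : slope alpha (D, d) < lam ->
    Qsum false D d lam - Qsum true D d lam = Ssum false D d lam - Ssum true D d lam.
  move=> sl; rewrite Qsum_jump// Ssum_jump.
  apply: eq_fsbigr => -[x y] /set_mem[/= d1 d2 sa ea].
  have sx : slope alpha x = lam by apply/eqP; rewrite slope_eq// ea.
  (* The total degree lies strictly below the total excess, and [x] has zero gap, so the strict
     inequality passes to [y]. *)
  have sy : slope alpha y < lam.
    have := slope_lteif alpha true lam d2 => /= ->.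
    have := slope_lteif alpha true lam (x := (D, d)) dD; rewrite /= sl => /esym.
    case: sa => <- <-; rewrite excessD; [|exact: d1.1|exact: d2.1].
    by rewrite intrD ea ltrD2l.
  have nxy : (nD D = nD x.1 + nD y.1)%N.
    by case: sa => <- _; rewrite nD_add; [|exact: d1.1|exact: d2.1].
  have [[_ n1] [_ n2]] := (d1, d2).
  congr (_ * (_ * _)).
    (* Rewriting the factor of [x] as [Qsum] at its own slope brings it under the induction
       hypothesis. *)
    rewrite -(@Qsum_slope _ _ _ alpha q x.1 x.2 lam) -?surjective_pairing//.
    apply: IH => //; last by rewrite -surjective_pairing /= sx.
    by rewrite -ltnS (leq_trans _ DN)// nxy -[leqLHS]addn1 leq_add2l.
  apply: IH => //; first by rewrite -ltnS (leq_trans _ DN)// nxy -[leqLHS]add1n leq_add2r.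
have main lam : slope alpha (D, d) <= lam -> Qsum false D d lam = Ssum false D d lam.
  move=> sl; apply: lser_eqP => n.
  pose F b mu := coefs n (Qsum b D d mu) - coefs n (Ssum b D d mu).
  apply/eqP; rewrite -subr_eq0; apply/eqP; rewrite -[LHS]/(F false lam).
  have [L1 H1] := Qsum_limit d n dD; have [L2 H2] := Ssum_limit d n dD.
  pose L := Num.max lam (Num.max L1 L2).
  have -> : F false lam = F false L.
    (* Between jumps the left limit at [b] is the value at [a]; at points above [lam], [jump]
       identifies value and left limit of the difference [F]. *)
    apply: (@descent _ _ (jumps D) (F false) (F true) _
             (fset_set (jumps D `&` [set x | lam < x < L]))).
    - by move=> a b ab H; rewrite /F (Qsum_nojump _ ab H) (Ssum_nojump _ ab H).
    - by rewrite le_max lexx.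
    - move=> x Jx xl; rewrite in_fset_set; last exact: finite_jumps.
      exact/mem_set.
    - move=> x /andP[lx _]; apply/eqP; rewrite -subr_eq0 /F.
      have := jump x (le_lt_trans sl lx) => /(congr1 (coefs n)).
      by rewrite !raddfB /= => h; apply/eqP; lra.
  by rewrite /F H1 ?H2 ?subrr// !le_max lexx !orbT.
move=> lam [] /= sl; last exact: main.
have := jump _ sl; rewrite main ?ltW// => /addrI /oppr_inj; exact.
Qed.

End Main.

Theorem theorem5p6 (R : realType) (S : finType) (m : S -> nat)
    (alpha : forall P : S, 'I_(m P) -> R)
    (hm : forall P, (0 < m P)%N)
    (halpha : forall P i, 0 <= alpha P i /\ alpha P i < 1)
    (hinc : forall P (i j : 'I_(m P)), (i < j)%N -> alpha P i < alpha P j)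
    (Q : data m -> int -> laurent) (Qb : data m -> laurent)
    (hQ : forall (D : data m) (d : int), is_data D ->
            HasSum (decomp alpha D d) (Qterm Q) (Qb D)) :
  forall (D : data m) (d : int) (lam : R), is_data D ->
    (d%:~R + alphaD alpha D) / (nD D)%:R <= lam ->
    exists L : laurent,
      HasSum (is_partition D) (Sterm alpha Qb D d lam) L /\
      HasSum (decomp_lam alpha D d lam) (Qterm Q) L.
Proof.
move=> D d lam dD sl.
pose q D d := ser (Q D d); pose qb D := ser (Qb D).
have E : Qsum alpha q false D d lam = Ssum alpha qb false D d lam.
  by apply: Qsum_eq_Ssum.
(* Both families are finite, so summability is immediate and the equality of finite sums provides
   the common sum. *)
exists (unser (Ssum alpha qb false D d lam)); split.
  apply: HasSum_finite; first exact: finite_parts.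
  rewrite unserK; apply: eq_fsbigr => I _.
  by rewrite (ser_Sterm alpha (qb := qb)).
apply: HasSum_finite; first exact: (finite_decomps alpha false).
rewrite unserK -E; apply: eq_fsbigr => s _.
by rewrite ser_Qterm.
Qed.
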